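(* Let $X$ and $Y$ be octahedral real Banach spaces and $N$ an absolute normalized norm on $\mathbb{R}^2$. Then $X\oplus_N Y$ is octahedral if and only if $(\mathbb{R}^2,N)$ is positively octahedral.
   Context: A real Banach space $X$ is octahedral if for every finite-dimensional subspace $E$ of $X$ and every $\varepsilon>0$ there is a norm one element $y\in X$ such that $\|x+y\|\geq(1-\varepsilon)(\|x\|+\|y\|)$ for all $x\in E$. A norm $N$ on $\mathbb{R}^2$ is absolute if $N(a,b)=N(|a|,|b|)$ for all $(a,b)\in\mathbb{R}^2$, and normalized if $N(1,0)=N(0,1)=1$. $X\oplus_N Y$ is the product space $X\times Y$ with the norm $\|(x,y)\|_N=N(\|x\|,\|y\|)$. An element $(a,b)\in\mathbb{R}^2$ is positive if $a\geq0$ and $b\geq0$. For an absolute normalized norm $N$, $(\mathbb{R}^2,N)$ is positively octahedral if whenever $n\in\mathbb{N}$ and $(a_1,b_1),\dots,(a_n,b_n)$ are positive elements of the unit sphere $S_{(\mathbb{R}^2,N)}$, there is a positive $(c,d)\in S_{(\mathbb{R}^2,N)}$ such that $N\big((a_i,b_i)+(c,d)\big)=2$ for all $i\in\{1,\dots,n\}$. *)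

(* Defs.v *)
From HB Require Import structures.
From mathcomp Require Import all_boot all_order all_algebra.
From mathcomp Require Import ring lra.
From mathcomp Require Import all_classical all_reals all_analysis.

Set Implicit Arguments.
Unset Strict Implicit.
Unset Printing Implicit Defensive.

Import Order.TTheory GRing.Theory Num.Theory.
Import numFieldNormedType.Exports.

Local Open Scope classical_set_scope.
Local Open Scope ring_scope.

Record absNorm (R : realType) := AbsNorm {
  absn :> R * R -> R ;
  absn_triangle : forall u v, absn (u + v) <= absn u + absn v ;
  absn_scale : forall (l : R) u, absn (l *: u) = `|l| * absn u ;
  absn_eq0 : forall u, absn u = 0 -> u = 0 ;
  absn_abs : forall a b, absn (a, b) = absn (`|a|, `|b|) ;
  absn10 : absn (1, 0) = 1 ;
  absn01 : absn (0, 1) = 1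
}.

Section AbsNormTheory.
Context {R : realType} (N : absNorm R).
Implicit Types a b c d : R.

Let scale_pair (l a b : R) : l *: ((a, b) : R * R) = (l * a, l * b).
Proof. by []. Qed.

Let add_pair a b c d : ((a, b) : R * R) + (c, d) = (a + c, b + d).
Proof. by []. Qed.

(* A point of the segment [-c, c] is a convex combination of its endpoints. *)
Let conv_sym a c : 0 <= a -> a <= c ->
  exists s t : R, [/\ 0 <= s, 0 <= t, s + t = 1 & a = s * c + t * - c].
Proof.
move=> a0; rewrite le_eqVlt => /predU1P[->|ac].
  by exists 1, 0; rewrite ler01 lexx addr0 mul1r mul0r addr0.
have c0 : 0 < c by exact: le_lt_trans ac.
exists ((1 + a / c) / 2), ((1 - a / c) / 2); split.
- by rewrite divr_ge0// addr_ge0// divr_ge0// ltW.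
- by rewrite divr_ge0// subr_ge0 ler_pdivrMr// mul1r ltW.
- by field; rewrite gt_eqF.
- by field; rewrite gt_eqF.
Qed.

Let absn_conv (u v : R * R) (s t : R) : 0 <= s -> 0 <= t -> s + t = 1 ->
  N v = N u -> N (s *: u + t *: v) <= N u.
Proof.
move=> s0 t0 st vu; apply: le_trans (absn_triangle _ _ _) _.
by rewrite !absn_scale vu !ger0_norm// -mulrDl st mul1r.
Qed.

Lemma absn_le1 a b c : 0 <= a -> a <= c -> N (a, b) <= N (c, b).
Proof.
move=> a0 /(conv_sym a0)[s [t [s0 t0 st ->]]].
have <- : s *: ((c, b) : R * R) + t *: (- c, b) = (s * c + t * - c, b).
  by rewrite !scale_pair add_pair -mulrDl st mul1r.
by apply: absn_conv => //; rewrite [LHS]absn_abs normrN -absn_abs.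
Qed.

Lemma absn_le2 a b d : 0 <= b -> b <= d -> N (a, b) <= N (a, d).
Proof.
move=> b0 /(conv_sym b0)[s [t [s0 t0 st ->]]].
have <- : s *: ((a, d) : R * R) + t *: (a, - d) = (a, s * d + t * - d).
  by rewrite !scale_pair add_pair -mulrDl st mul1r.
by apply: absn_conv => //; rewrite [LHS]absn_abs normrN -absn_abs.
Qed.

Lemma absn_le a b c d :
  0 <= a -> 0 <= b -> a <= c -> b <= d -> N (a, b) <= N (c, d).
Proof.
by move=> a0 b0 ac bd; apply: le_trans (absn_le1 _ a0 ac) (absn_le2 _ b0 bd).
Qed.

Lemma absn_a0 a : N (a, 0) = `|a|.
Proof.
have -> : (a, 0) = a *: ((1, 0) : R * R).
  by rewrite scale_pair mulr1 mulr0.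
by rewrite absn_scale absn10 mulr1.
Qed.

Lemma absn_0b b : N (0, b) = `|b|.
Proof.
have -> : (0, b) = b *: ((0, 1) : R * R).
  by rewrite scale_pair mulr1 mulr0.
by rewrite absn_scale absn01 mulr1.
Qed.

End AbsNormTheory.

(* The library norms X * Y by the maximum; the alias absSum carries N instead. *)
Definition absSum (R : realType) (N : absNorm R) (X Y : normedModType R) : Type :=
  (X * Y)%type.

Section AbsSumNorm.
Context {R : realType} (N : absNorm R) (X Y : normedModType R).
Local Notation S := (absSum N X Y).

HB.instance Definition _ := GRing.Lmodule.copy S (X * Y)%type.

Definition absSum_norm (z : S) : R := N (`|z.1|, `|z.2|).

Lemma absSum_normD (z w : S) :
  absSum_norm (z + w) <= absSum_norm z + absSum_norm w.
Proof.
apply: le_trans (absn_triangle N _ _); apply: absn_le => //; exact: ler_normD.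
Qed.

Lemma absSum_normZ (l : R) (z : S) :
  absSum_norm (l *: z) = `|l| * absSum_norm z.
Proof. by rewrite /absSum_norm -[`|l|]normr_id -absn_scale /= !normrZ. Qed.

Lemma absSum_norm_eq0 (z : S) : absSum_norm z = 0 -> z = 0.
Proof.
by case: z => x y /absn_eq0[/eqP + /eqP]; rewrite !normr_eq0 => /eqP-> /eqP->.
Qed.

HB.instance Definition _ := @Lmodule_isNormed.Build R S absSum_norm
  absSum_normD absSum_normZ absSum_norm_eq0.

Lemma absSum_normE (z : S) : `|z| = N (`|z.1|, `|z.2|).
Proof. by []. Qed.

End AbsSumNorm.

Section AbsSumComplete.
Context {R : realType} (N : absNorm R) (X Y : completeNormedModType R).
Local Notation S := (absSum N X Y).

Lemma absSum_complete (F : set_system S) : ProperFilter F -> cauchy F -> cvg F.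
Proof.
move=> FF /cauchy_ballP Fc.
pose f (z : S) : X := z.1; pose g (z : S) : Y := z.2.
have fc : cvg (f @ F).
  apply: cauchy_cvg; apply/cauchy_ballP => e e0; near_simpl.
  have := Fc e e0; apply: filterS => -[z w] /=.
  rewrite -!ball_normE /=; apply: le_lt_trans.
  by rewrite absSum_normE -[leLHS]normr_id -(absn_a0 N) absn_le.
have gc : cvg (g @ F).
  apply: cauchy_cvg; apply/cauchy_ballP => e e0; near_simpl.
  have := Fc e e0; apply: filterS => -[z w] /=.
  rewrite -!ball_normE /=; apply: le_lt_trans.
  by rewrite absSum_normE -[leLHS]normr_id -(absn_0b N) absn_le.
apply/cvg_ex; exists ((lim (f @ F), lim (g @ F)) : S).
apply/fcvgrPdist_lt => e e0.
have e20 : 0 < e / 2 by rewrite divr_gt0.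
near=> z.
rewrite absSum_normE /= [e]splitr.
have -> : (`|lim (f @ F) - z.1|, `|lim (g @ F) - z.2|)
  = (`|lim (f @ F) - f z|, 0) + (0, `|lim (g @ F) - g z|) :> R * R.
  by congr pair; rewrite /= ?addr0 ?add0r.
apply: le_lt_trans (absn_triangle _ _ _) _.
rewrite absn_a0 absn_0b !normr_id ltrD//; near: z.
  by move/cvgrPdist_lt: fc; apply.
by move/cvgrPdist_lt: gc; apply.
Unshelve. all: by end_near. Qed.

HB.instance Definition _ := Uniform_isComplete.Build S absSum_complete.

End AbsSumComplete.

Definition finite_dim_subspace (R : realType) (V : lmodType R) (E : set V) :=
  exists (n : nat) (e : 'I_n -> V),
    E = [set x | exists c : 'I_n -> R, x = \sum_(i < n) c i *: e i].

Definition octahedral (R : realType) (X : completeNormedModType R) :=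
  forall E : set X, finite_dim_subspace E -> forall eps : R, 0 < eps ->
    exists y : X, `|y| = 1 /\
      forall x, E x -> (1 - eps) * (`|x| + `|y|) <= `|x + y|.

Definition positive_elt (R : realType) (u : R * R) := 0 <= u.1 /\ 0 <= u.2.

Definition positively_octahedral (R : realType) (N : absNorm R) :=
  forall (n : nat) (u : 'I_n -> R * R),
    (forall i, positive_elt (u i) /\ N (u i) = 1) ->
    exists v : R * R, [/\ positive_elt v, N v = 1 & forall i, N (u i + v) = 2].

(* Main.v *)
Require Import Defs.
From mathcomp Require Import all_boot all_order all_algebra.
From mathcomp Require Import lra.
From mathcomp Require Import all_classical all_reals all_analysis.

(** Positive octahedrality of the plane is a condition on the two basis vectors
    only: if [v] is positive of norm one and [N ((1, 0) + v) = N ((0, 1) + v) = 2],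
    then [N (u + v) = N u + 1] for every positive [u] ([absnD_corner]).  Indeed
    additivity of a norm on two vectors extends to the cone that they span
    ([absn_cone]), and the quadrant is the union of the cone of [(1, 0)] and
    [v] and the cone of [v] and [(0, 1)].

    Given such a corner [v = (c, d)] and octahedral [X] and [Y], a
    finite-dimensional subspace of the sum projects onto finite-dimensional
    subspaces of [X] and [Y]; if [x0] and [y0] witness octahedrality for these
    projections, then [(c x0, d y0)] witnesses it for the subspace, because
    [N] is monotone on the quadrant and additive at [v].

    Conversely, take unit vectors [x1] of [X] and [y1] of [Y].  Octahedrality of
    the sum for the span of [(x1, 0)] and [(0, y1)] gives unit vectors [(x, y)]
    for which [(`|x|, `|y|)] is a corner up to [eps].  The positive part of the
    unit sphere of the plane is compact, so letting [eps] tend to [0] yields an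
    exact corner ([corner_of_approx]). *)

Set Implicit Arguments.
Unset Strict Implicit.
Unset Printing Implicit Defensive.

Import Order.TTheory GRing.Theory Num.Theory.
Import numFieldNormedType.Exports.

Local Open Scope classical_set_scope.
Local Open Scope ring_scope.

(** * Absolute norms on the quadrant *)

Section Plane.
Context {R : realType} (N : absNorm R).
Implicit Types u v : R * R.

(** Where [N] is additive along both basis vectors, the positive part of the
    unit sphere consists of the segments joining [v] to [(1, 0)] and [(0, 1)],
    hence the name. *)
Definition corner v := [/\ positive_elt v, N v = 1,
  N ((1, 0) + v) = 2 & N ((0, 1) + v) = 2].

(** When [s <= t], write [s u + t v] as [t (u + v) - (t - s) u]: the reverse
    triangle inequality already gives the sharp lower bound.  The case [t <= s]
    is symmetric. *)
Lemma absn_cone u v (s t : R) : N (u + v) = N u + N v -> 0 <= s -> 0 <= t ->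
  N (s *: u + t *: v) = s * N u + t * N v.
Proof.
move=> uv s0 t0; apply/eqP; rewrite eq_le; apply/andP; split.
  apply: le_trans (absn_triangle _ _ _) _.
  by rewrite !absn_scale !ger0_norm.
have [st|/ltW ts] := leP s t.
  have := absn_triangle N (s *: u + t *: v) ((t - s) *: u).
  have -> : s *: u + t *: v + (t - s) *: u = t *: (u + v).
    by rewrite addrAC -scalerDl [s + _]addrC subrK -scalerDr.
  rewrite !absn_scale uv !ger0_norm ?subr_ge0//; lra.
have := absn_triangle N (s *: u + t *: v) ((s - t) *: v).
have -> : s *: u + t *: v + (s - t) *: v = s *: (u + v).
  by rewrite -addrA -scalerDl [t + _]addrC subrK -scalerDr.
rewrite !absn_scale uv !ger0_norm ?subr_ge0//; lra.
Qed.

Lemma absnD_cone u v (s t : R) : N (u + v) = N u + N v -> 0 <= s -> 0 <= t ->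
  N (s *: u + t *: v + v) = N (s *: u + t *: v) + N v.
Proof.
move=> uv s0 t0; rewrite -addrA -[X in _ + (_ + X)]scale1r -scalerDl.
by rewrite !absn_cone ?addr_ge0//; lra.
Qed.

(** The line through [v] cuts the quadrant into two cones, each spanned by [v]
    and a basis vector. *)
Lemma absnD_corner u v : corner v -> positive_elt u -> N (u + v) = N u + 1.
Proof.
case: v => c d; case: u => a b [[/= c0 d0] v1 e1 e2] [/= a0 b0].
have [h|/ltW h] := leP (b * c) (a * d).
- have [s [t [s0 t0 ->]]] : exists s t : R, [/\ 0 <= s, 0 <= t &
      (a, b) = s *: ((1, 0) : R * R) + t *: (c, d)].
    (* Here [v] is [(1, 0)] and the cone degenerates to the first axis. *)
    have [d00|dn0] := eqVneq d 0.
      move: v1 h; rewrite d00 absn_a0 ger0_norm// => ->; rewrite mulr0 mulr1 => h.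
      by exists a, 0; split => //; congr pair; rewrite /= ?/(_ *: _) /=; lra.
    have d1 : 0 < d by rewrite lt_neqAle eq_sym dn0.
    exists (a - b * c / d), (b / d); split.
    - by rewrite subr_ge0 ler_pdivrMr.
    - exact: divr_ge0.
    - congr pair; rewrite /= ?/(_ *: _) /=; first by rewrite mulr1 mulrAC subrK.
      by rewrite mulr0 add0r divfK.
  by rewrite absnD_cone ?v1// e1 absn10; lra.
- have [s [t [s0 t0 ->]]] : exists s t : R, [/\ 0 <= s, 0 <= t &
      (a, b) = s *: ((0, 1) : R * R) + t *: (c, d)].
    (* Here [v] is [(0, 1)] and the cone degenerates to the second axis. *)
    have [c00|cn0] := eqVneq c 0.
      move: v1 h; rewrite c00 absn_0b ger0_norm// => ->; rewrite mulr0 mulr1 => h.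
      by exists b, 0; split => //; congr pair; rewrite /= ?/(_ *: _) /=; lra.
    have c1 : 0 < c by rewrite lt_neqAle eq_sym cn0.
    exists (b - a * d / c), (a / c); split.
    - by rewrite subr_ge0 ler_pdivrMr.
    - exact: divr_ge0.
    - congr pair; rewrite /= ?/(_ *: _) /=; first by rewrite mulr0 add0r divfK.
      by rewrite mulr1 mulrAC subrK.
  by rewrite absnD_cone ?v1// e2 absn01; lra.
Qed.

Lemma positively_octahedralP :
  positively_octahedral N <-> exists v, corner v.
Proof.
split=> [octN|[v cv] n u u1].
  pose e (i : 'I_2) : R * R := if i == ord0 then (1, 0) else (0, 1).
  have [|v [v0 v1 ev]] := octN 2%N e.
    move=> i; rewrite /e; case: ifP => _; rewrite ?absn10 ?absn01.
      by split=> //; split; rewrite /= ?ler01.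
    by split=> //; split; rewrite /= ?ler01.
  by exists v; split=> //; [exact: (ev ord0)|exact: (ev ord_max)].
exists v; have [v0 v1 _ _] := cv; split=> // i.
by have [u0 ui1] := u1 i; rewrite (absnD_corner cv u0) ui1.
Qed.

Lemma absn_continuous : continuous (N : R * R -> R).
Proof.
move=> u; apply/cvgrPdist_le => e e0.
have e20 : 0 < e / 2 by rewrite divr_gt0.
near=> v.
have uv : `|u - v| <= e / 2.
  near: v; move: (e / 2) e20; apply/cvgrPdist_le; exact: cvg_id.
have small w : `|w| <= e / 2 -> N w <= e.
  case: w => a b; rewrite prod_normE/= ge_max => /andP[ha hb].
  have -> : (a, b) = ((a, 0) + (0, b) : R * R).
    by congr pair; rewrite /= ?addr0 ?add0r.
  by apply: le_trans (absn_triangle _ _ _) _; rewrite absn_a0 absn_0b; lra.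
have h1 := small _ uv.
have h2 : N (v - u) <= e by apply: small; rewrite distrC.
have := absn_triangle N (u - v) v; rewrite subrK => h3.
have := absn_triangle N (v - u) u; rewrite subrK => h4.
by rewrite ler_norml; apply/andP; split; lra.
Unshelve. all: by end_near. Qed.

Lemma compact_positive_sphere : compact [set v | positive_elt v /\ N v = 1].
Proof.
have -> : [set v | positive_elt v /\ N v = 1] =
    (`[0, 1] `*` `[0, 1]) `&` (N : R * R -> R) @^-1` [set x | x = 1].
  apply/seteqP; split=> -[a b] /=.
    move=> [[/= a0 b0] ab]; rewrite !in_itv /= a0 b0/=.
    split=> //; split.
      rewrite -ab -{1}(ger0_norm a0) -(absn_a0 N).
      exact: absn_le.
    rewrite -ab -{1}(ger0_norm b0) -(absn_0b N).
    exact: absn_le.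
  by rewrite !in_itv /= => -[[/andP[a0 _] /andP[b0 _]] ->].
apply: compact_closedI; first by apply: compact_setX; exact: segment_compact.
apply: preimage_closed; last exact: closed_eq.
by move=> u _; exact: absn_continuous.
Qed.

(** A maximizer of the smaller of [N ((1, 0) + v)] and [N ((0, 1) + v)] over the
    positive part of the sphere is a corner: the triangle inequality caps both
    at 2. *)
Lemma corner_of_approx :
  (forall eps, 0 < eps -> exists v, [/\ positive_elt v, N v = 1,
     2 - eps <= N ((1, 0) + v) & 2 - eps <= N ((0, 1) + v)]) ->
  exists v, corner v.
Proof.
move=> approx.
pose f (v : R * R) : R := Num.min (N ((1, 0) + v)) (N ((0, 1) + v)).
have cN w : continuous (fun v => N (w + v)).
  move=> v; apply: (@continuous_comp _ _ _ (fun v : R * R => w + v) N).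
    by apply: cvgD; [exact: cvg_cst|exact: cvg_id].
  exact: absn_continuous.
have cf : continuous f.
  by move=> v; exact: (continuous_min (@cN (1, 0) v) (@cN (0, 1) v)).
have [|v] := compact_EVT_max _ compact_positive_sphere
  (continuous_subspaceT cf).
  by have [v [v0 v1 _ _]] := approx 1 ltr01; exists v.
rewrite inE /= => -[v0 v1] vmax.
have f2 : 2 <= f v.
  apply/ler_addgt0Pr => eps eps0.
  have [w [w0 w1 h1 h2]] := approx eps eps0.
  have fw : f w <= f v by apply: vmax; rewrite inE.
  by rewrite -lerBlDr; apply: le_trans fw; rewrite le_min h1.
move: f2; rewrite le_min => /andP[h1 h2].
exists v; split=> //; apply/eqP; rewrite eq_le ?h1 ?h2 andbT.
  by apply: le_trans (absn_triangle _ _ _) _; rewrite absn10 v1; lra.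
by apply: le_trans (absn_triangle _ _ _) _; rewrite absn01 v1; lra.
Qed.

End Plane.

(** * Finite-dimensional subspaces and octahedral spaces *)

Section Octahedral.
Context {R : realType}.

Lemma finite_dim_subspace_image (V W : lmodType R) (f : {linear V -> W})
    (E : set V) : finite_dim_subspace E -> finite_dim_subspace (f @` E).
Proof.
move=> [n [e ->]]; exists n, (f \o e); apply/seteqP; split=> w /=.
  move=> [_ [c ->] <-]; exists c; rewrite linear_sum.
  by apply: eq_bigr => i _; rewrite linearZ.
move=> [c ->]; exists (\sum_(i < n) c i *: e i); first by exists c.
by rewrite linear_sum; apply: eq_bigr => i _; rewrite linearZ.
Qed.

Lemma finite_dim_subspaceZ (V : lmodType R) (E : set V) (l : R) x :
  finite_dim_subspace E -> E x -> E (l *: x).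
Proof.
move=> [n [e ->]] [c ->]; exists (fun i => l * c i).
by rewrite scaler_sumr; apply: eq_bigr => i _; rewrite scalerA.
Qed.

Lemma finite_dim_subspace2 (V : lmodType R) (u v : V) :
  exists E : set V, [/\ finite_dim_subspace E, E u & E v].
Proof.
pose e (i : 'I_2) : V := if i == ord0 then u else v.
exists [set x | exists c : 'I_2 -> R, x = \sum_(i < 2) c i *: e i].
split; first by exists 2%N, e.
- exists (fun i => if i == ord0 then 1 else 0).
  by rewrite big_ord_recl big_ord1 /e /= scale1r scale0r addr0.
- exists (fun i => if i == ord0 then 0 else 1).
  by rewrite big_ord_recl big_ord1 /e /= scale1r scale0r add0r.
Qed.

Lemma octahedral_unit (X : completeNormedModType R) :
  octahedral X -> exists x : X, `|x| = 1.
Proof.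
move=> octX; have [E [fE _ _]] := finite_dim_subspace2 (0 : X) 0.
by have [x [x1 _]] := octX E fE 1 ltr01; exists x.
Qed.

(** By homogeneity a witness of octahedrality also works for its nonnegative
    multiples, since the subspace is stable under scaling. *)
Lemma octahedral_scale (X : completeNormedModType R) (E : set X) (eps : R) :
  octahedral X -> finite_dim_subspace E -> 0 < eps ->
  exists y : X, `|y| = 1 /\ forall x c, E x -> 0 <= c ->
    (1 - eps) * (`|x| + c) <= `|x + c *: y|.
Proof.
move=> octX fE eps0; have [y [y1 hy]] := octX E fE eps eps0.
exists y; split=> // x c Ex; rewrite le_eqVlt => /predU1P[<-|c0].
  by rewrite scale0r !addr0 ler_piMl//; lra.
have := hy _ (finite_dim_subspaceZ c^-1 fE Ex).
have -> : x + c *: y = c *: (c^-1 *: x + y).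
  by rewrite scalerDr scalerA divff ?gt_eqF// scale1r.
rewrite y1 !normrZ normfV !gtr0_norm// => h.
have -> : (1 - eps) * (`|x| + c) = c * ((1 - eps) * (c^-1 * `|x| + 1)).
  by rewrite mulrCA [c * _]mulrDr mulr1 mulrA divff ?gt_eqF// mul1r.
by rewrite ler_pM2l.
Qed.

End Octahedral.

(** * The absolute sum *)

Section AbsSum.
Context {R : realType} (X Y : completeNormedModType R) (N : absNorm R).

Lemma octahedral_of_corner (v : R * R) : octahedral X -> octahedral Y ->
  corner N v -> octahedral (absSum N X Y).
Proof.
case: v => c d octX octY cv E fE eps0 eps0_gt0.
(* The lower bounds on norms must be nonnegative for [N] to be monotone. *)
pose eps := Num.min eps0 1.
have eps_gt0 : 0 < eps by rewrite lt_min eps0_gt0 ltr01.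
have eps_le1 : eps <= 1 by rewrite ge_min lexx orbT.
have eps_le : eps <= eps0 by rewrite ge_min lexx.
have [[/= c0 d0] v1 _ _] := cv.
have [x0 [x01 hx0]] := octahedral_scale octX
  (finite_dim_subspace_image (@fst X Y : {linear (X * Y)%type -> X}) fE) eps_gt0.
have [y0 [y01 hy0]] := octahedral_scale octY
  (finite_dim_subspace_image (@snd X Y : {linear (X * Y)%type -> Y}) fE) eps_gt0.
pose z : absSum N X Y := (c *: x0, d *: y0).
have z1 : `|z| = 1.
  by rewrite absSum_normE /z /= !normrZ x01 y01 !mulr1 !ger0_norm.
exists z; split=> // w Ew; rewrite z1.
have w0 : 0 <= `|w| by [].
apply: (@le_trans _ _ ((1 - eps) * (`|w| + 1))).
  by apply: ler_wpM2r; [rewrite addr_ge0|lra].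
have -> : (1 - eps) * (`|w| + 1) =
    N ((1 - eps) * (`|w.1| + c), (1 - eps) * (`|w.2| + d)).
  rewrite absSum_normE -(absnD_corner cv); last by split=> /=.
  by rewrite -[X in X * _]ger0_norm ?subr_ge0// -absn_scale.
rewrite absSum_normE; apply: absn_le.
- by rewrite mulr_ge0 ?subr_ge0 ?addr_ge0.
- by rewrite mulr_ge0 ?subr_ge0 ?addr_ge0.
- by apply: hx0 => //; exists w.
- by apply: hy0 => //; exists w.
Qed.

Lemma corner_of_octahedral (x1 : X) (y1 : Y) : `|x1| = 1 -> `|y1| = 1 ->
  octahedral (absSum N X Y) -> exists v, corner N v.
Proof.
move=> nx1 ny1 octS; apply: corner_of_approx => eps eps0.
pose e1 : absSum N X Y := (x1, 0); pose e2 : absSum N X Y := (0, y1).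
have ne1 : `|e1| = 1 by rewrite absSum_normE /= nx1 normr0 absn10.
have ne2 : `|e2| = 1 by rewrite absSum_normE /= ny1 normr0 absn01.
have [E [fE Ee1 Ee2]] := finite_dim_subspace2 e1 e2.
have eps20 : 0 < eps / 2 by rewrite divr_gt0.
have [z [z1 hz]] := octS E fE (eps / 2) eps20.
exists (`|z.1|, `|z.2|); split; [by split=> /=|by rewrite -absSum_normE| |].
- have := hz _ Ee1; rewrite ne1 z1 => h.
  apply: (@le_trans _ _ `|e1 + z|); first by move: h; lra.
  rewrite absSum_normE; apply: absn_le => //=.
    by rewrite -nx1; exact: ler_normD.
  by rewrite !add0r.
- have := hz _ Ee2; rewrite ne2 z1 => h.
  apply: (@le_trans _ _ `|e2 + z|); first by move: h; lra.
  rewrite absSum_normE; apply: absn_le => //=.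
    by rewrite !add0r.
  by rewrite -ny1; exact: ler_normD.
Qed.

End AbsSum.

Theorem theorem3p2 (R : realType) (X Y : completeNormedModType R)
    (N : absNorm R) (octX : octahedral X) (octY : octahedral Y) :
  octahedral (absSum N X Y) <-> positively_octahedral N.
Proof.
split=> [octS|/positively_octahedralP[v cv]]; last exact: octahedral_of_corner cv.
have [x1 nx1] := octahedral_unit octX; have [y1 ny1] := octahedral_unit octY.
by apply/positively_octahedralP; exact: corner_of_octahedral nx1 ny1 octS.
Qed.
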